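(* Let $\Delta=[0,\infty[\subset\mathbf{R}$ be equipped with the subset diffeology, with standard coordinate $x$, and let $\tau_{\mathrm{sing}}=\dfrac{dx\otimes dx}{x}$. On $\Delta$, a Riemannian metric cannot contain a singular part; i.e., if $g=c\,\tau_{\mathrm{sing}}+\tau_{\mathrm{reg}}$ is a Riemannian metric on $\Delta$, where $c\in\mathbf{R}$ and $\tau_{\mathrm{reg}}$ is the restriction to $\Delta$ of a smooth symmetric $2$-tensor on $\mathbf{R}$, then $c=0$.
   Context: Subset diffeology: the plots of $\Delta$ are the maps $P\colon U\to\Delta$, with $U$ an open subset of some $\mathbf{R}^m$ ($m\ge 0$ arbitrary), that are smooth as maps into $\mathbf{R}$. Smooth symmetric covariant $2$-tensor on a diffeological space $X$: a map $\tau$ assigning to each plot $P\colon U\to X$ a smooth symmetric covariant $2$-tensor $\tau(P)$ (also written $P^*(\tau)$) on $U$, such that $\tau(P\circ F)=F^*(\tau(P))$ for every smooth $F\colon V\to U$ with $V$ open in a Euclidean space. Differential $1$-forms on $X$ are defined in the same way, with $\alpha(P)$ a smooth $1$-form on $U$. The restriction to $\Delta$ of a smooth tensor $\sigma$ on $\mathbf{R}$ is $P\mapsto P^*(\sigma)$. The tensor $\tau_{\mathrm{sing}}$ is the symmetric $2$-tensor given on $]0,\infty[$ by $dx\otimes dx/x$; its pullback by a plot $P$ is given by $\dfrac{dP\otimes dP}{P}$ where $P>0$, extended smoothly to the whole domain of $P$. Riemannian metric on a diffeological space $X$: a smooth symmetric covariant $2$-tensor $g$ that is (1) Positive: for every $x\in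 X$ and every (germ of) path $\gamma\in\mathrm{Paths}(X)$ with $\gamma(0)=x$, $g(\gamma)_0(1,1)\ge 0$. (2) Definite: for every $x\in X$ and every plot $\gamma$ centered at $x$, $$g(\gamma)_0(1,1)=0\iff \forall\alpha\in\Lambda^1_x(X),\ \alpha(\gamma)_0(1)=0.$$ Here a path is a one-parameter plot; a plot $\gamma$ centered at $x$ is in this definition a one-parameter plot defined on an open neighborhood of $0$ in $\mathbf{R}$ with $\gamma(0)=x$; $g(\gamma)_0(1,1)$ is the value at $t=0$ of the tensor $g(\gamma)$ on the pair of tangent vectors $(1,1)$; $\alpha(\gamma)_0(1)$ is the value at $t=0$ of the $1$-form $\alpha(\gamma)$ on the vector $1$; and $\Lambda^1_x(X)$ is the space of pointed $1$-forms at $x$, i.e. of $1$-forms on $X$ considered through their values at $0$ on plots centered at $x$. *)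

(* Defs.v *)
From HB Require Import structures.
From mathcomp Require Import all_boot all_order all_algebra.
From mathcomp Require Import all_classical all_reals all_analysis.
Import Order.TTheory GRing.Theory Num.Theory numFieldNormedType.Exports.

Set Implicit Arguments.
Unset Strict Implicit.
Unset Printing Implicit Defensive.

Local Open Scope ring_scope.
Local Open Scope classical_set_scope.

(* [f] is of class C^k on [U].  Used with [U] open and [V] equal to R or R^m:
   a map on an open subset of R^m is represented by a total function whose
   values outside the open set are irrelevant. *)
Fixpoint Ck (R : realType) (V W : normedModType R) (k : nat) (U : set V)
    (f : V -> W) : Prop :=
  match k with
  | 0 => forall x, U x -> {for x, continuous f}
  | k'.+1 => (forall x, U x -> differentiable f x) /\
             (forall v, Ck k' U ('D_v f))
  end.

Definition smooth (R : realType) (V W : normedModType R) (U : set V)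
    (f : V -> W) : Prop := forall k, Ck k U f.

Section SmoothTheory.
Context {R : realType}.
Implicit Types V W : normedModType R.

Lemma differentiable_eq_on V W (U : set V) (f g : V -> W) x :
  open U -> U x -> (forall y, U y -> f y = g y) ->
  differentiable f x -> differentiable g x.
Proof.
move=> oU Ux fg df.
have nfg : \forall y \near x, f y = g y.
  by apply: filterS (open_nbhs_nbhs (conj oU Ux)) => y /fg.
have [cd /eqaddoP Hf] := (diff_locallyP x f).1 df.
have Hg : g \o shift x = cst (g x) + 'd f x +o_ 0 id.
  apply/eqaddoP => e e0.
  have n0 : \forall h \near (0 : V), f (h + x) = g (h + x).
    by move: nfg; rewrite (near_shift 0) /= subr0.
  near=> h.
  have -> : (g \o shift x - (cst (g x) + 'd f x)) h =
            (f \o shift x - (cst (f x) + 'd f x)) h.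
    rewrite -[LHS]/(g (h + x) - (g x + 'd f x h)).
    rewrite -[RHS]/(f (h + x) - (f x + 'd f x h)).
    have <- : f (h + x) = g (h + x) by near: h.
    by rewrite -(fg x Ux).
  by near: h; apply: Hf.
have E := diff_unique cd Hg.
by apply/diff_locallyP; rewrite E.
Unshelve. all: by end_near. Qed.

Lemma Ck_eq_on V W k (U : set V) (f g : V -> W) :
  open U -> (forall y, U y -> f y = g y) -> Ck k U f -> Ck k U g.
Proof.
move=> oU; elim: k f g => [|k IH] f g fg /=.
  move=> cf x Ux; have nU := open_nbhs_nbhs (conj oU Ux).
  rewrite /prop_for /continuous_at -fg //.
  apply: cvg_trans (cf x Ux); apply: near_eq_cvg.
  by apply: filterS nU => y /fg.
move=> [df Df]; split=> [x Ux|v].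
  exact: (differentiable_eq_on oU Ux fg (df x Ux)).
apply: IH (Df v) => y Uy; apply: near_eq_derive.
by apply: filterS (open_nbhs_nbhs (conj oU Uy)) => z /fg.
Qed.

Lemma Ck_local V W k (U : set V) (f : V -> W) :
  (forall x, U x -> exists2 U', U' x & Ck k U' f) -> Ck k U f.
Proof.
elim: k f => [|k IH] f H /=.
  by move=> x /H[U' U'x]; apply.
split=> [x /H[U' U'x [Df _]]|v]; first exact: Df.
by apply: IH => x /H[U' U'x [_ Df]]; exists U'; last exact: Df.
Qed.

Lemma Ck_sub V W k (U U' : set V) (f : V -> W) :
  U' `<=` U -> Ck k U f -> Ck k U' f.
Proof.
move=> sU; elim: k f => [|k IH] f /= => [H x /sU|[H1 H2]]; first exact: H.
by split=> [x /sU /H1|v] //; apply: IH.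
Qed.

Lemma CkW V W k (U : set V) (f : V -> W) : Ck k.+1 U f -> Ck k U f.
Proof.
elim: k f => [|k IH] f [df Df].
  by move=> x Ux; apply/differentiable_continuous/df.
by split=> // v; apply: IH; apply: Df.
Qed.

Lemma Ck_cst V W k (U : set V) (a : W) : Ck k U (cst a).
Proof.
elim: k a => [|k IH] a; first by move=> x _; exact: cst_continuous.
split=> [x _|v]; first exact: differentiable_cst.
have -> : 'D_v (cst a : V -> W) = cst 0 by apply/funext => x; rewrite derive_cst.
exact: IH.
Qed.

Lemma Ck_add V W k (U : set V) (f g : V -> W) : open U ->
  Ck k U f -> Ck k U g -> Ck k U (f + g).
Proof.
move=> oU; elim: k f g => [|k IH] f g.
  by move=> cf cg x Ux; apply: continuousD; [exact: cf|exact: cg].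
move=> [df Df] [dg Dg]; split=> [x Ux|v].
  by apply: differentiableD; [exact: df|exact: dg].
apply: (Ck_eq_on oU) (IH _ _ (Df v) (Dg v)) => y Uy.
by rewrite deriveD //; apply: diff_derivable; [exact: df|exact: dg].
Qed.

Lemma Ck_sum V W k n (U : set V) (f : 'I_n -> V -> W) : open U ->
  (forall i, Ck k U (f i)) -> Ck k U (fun x => \sum_i f i x).
Proof.
move=> oU; elim: n f => [|n IH] f Hf.
  by rewrite (_ : (fun _ => _) = cst 0); [exact: Ck_cst|
    apply/funext => x; rewrite big_ord0].
rewrite (_ : (fun _ => _) =
  (fun x => \sum_(i < n) f (widen_ord (leqnSn n) i) x) + f ord_max).
  by apply: (Ck_add oU); [apply: IH|].
by apply/funext => x; rewrite big_ord_recr.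
Qed.

Lemma Ck_mul V k (U : set V) (f g : V -> R) : open U ->
  Ck k U f -> Ck k U g -> Ck k U (f * g).
Proof.
move=> oU; elim: k f g => [|k IH] f g.
  by move=> cf cg x Ux; apply: continuousM; [exact: cf|exact: cg].
move=> Cf Cg; have [df Df] := Cf; have [dg Dg] := Cg; split=> [x Ux|v].
  by apply: differentiableM; [exact: df|exact: dg].
apply: (Ck_eq_on oU) (Ck_add oU (IH _ _ (CkW Cf) (Dg v))
  (IH _ _ (CkW Cg) (Df v))) => y Uy.
by rewrite deriveM //; apply: diff_derivable; [exact: df|exact: dg].
Qed.

Lemma Ck_coord V k m (U : set V) (f : V -> 'rV[R]_m) (j : 'I_m) : open U ->
  Ck k U f -> Ck k U (fun x => f x ord0 j).
Proof.
move=> oU; elim: k f => [|k IH] f.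
  move=> cf x Ux.
  by apply: (@continuous_comp _ _ _ f (fun M : 'rV[R]_m => M ord0 j));
    [exact: cf|exact: coord_continuous].
move=> [df Df]; split=> [x Ux|v].
  by apply: (@differentiable_comp _ _ _ _ f (fun M : 'rV[R]_m => M ord0 j));
    [exact: df|exact: differentiable_coord].
apply: (Ck_eq_on oU) (IH _ (Df v)) => y Uy.
by rewrite derive_mx ?mxE //; apply: diff_derivable; exact: df.
Qed.

Lemma Ck_comp V k m (U : set 'rV[R]_m) (U' : set V) (f : 'rV[R]_m -> R)
    (F : V -> 'rV[R]_m) : open U' -> (forall x, U' x -> U (F x)) ->
  Ck k U f -> Ck k U' F -> Ck k U' (f \o F).
Proof.
move=> oU' FU; elim: k f => [|k IH] f.
  move=> cf cF x U'x.
  by apply: continuous_comp; [exact: cF|apply: cf; exact: FU].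
move=> [df Df] CF; have [dF DF] := CF; split=> [x U'x|v].
  by apply: differentiable_comp; [exact: dF|apply: df; exact: FU].
apply: (Ck_eq_on oU' _ (@Ck_sum _ _ k m U' (fun j =>
  (fun x => ('D_v F x) ord0 j) * ('D_('e_j) f \o F)) oU' _)).
  move=> y U'y; have dfy := df _ (FU _ U'y); have dFy := dF _ U'y.
  have -> : 'D_v (f \o F) y = 'd f (F y) ('D_v F y).
    rewrite deriveE; last exact: differentiable_comp.
    by rewrite diff_comp //= (deriveE v dFy).
  have lin (w : 'rV[R]_m) :
      'd f (F y) w = \sum_j w ord0 j * 'D_('e_j) f (F y).
    rewrite {1}(row_sum_delta w) linear_sum /=.
    by apply: eq_bigr => j _; rewrite linearZ /= -deriveE.
  by rewrite lin.
move=> j; apply: (Ck_mul oU'); first exact: (Ck_coord j oU' (DF v)).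
by apply: IH; [exact: Df|exact: CkW].
Qed.

End SmoothTheory.

(* A map [P] on an open set [U] is total (see [Ck]); [plot U P] may only depend
   on the restriction of [P] to [U], which is [plot_eq_on]. *)
Record diffeology (R : realType) (X : Type) := Diffeology {
  plot : forall m, set 'rV[R]_m -> ('rV[R]_m -> X) -> Prop;
  plot_open : forall m (U : set 'rV[R]_m) P, plot U P -> open U;
  plot_eq_on : forall m (U : set 'rV[R]_m) (P Q : 'rV[R]_m -> X),
    (forall u, U u -> P u = Q u) -> plot U P -> plot U Q;
  plot_cst : forall m (U : set 'rV[R]_m) (x : X),
    open U -> plot U (fun=> x);
  plot_local : forall m (U : set 'rV[R]_m) P, open U ->
    (forall u, U u -> exists2 U', U' u & plot U' P) -> plot U P;
  plot_comp : forall m n (U : set 'rV[R]_m) (V : set 'rV[R]_n) P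
      (F : 'rV[R]_n -> 'rV[R]_m),
    plot U P -> open V -> smooth V F -> (forall v, V v -> U (F v)) ->
    plot V (P \o F)
}.

Section Tensors.
Context {R : realType}.
Implicit Types V W : normedModType R.

Definition smooth_form1 V (U : set V) (a : V -> V -> R) : Prop :=
  (forall u, U u -> scalar (a u)) /\ (forall v, smooth U (a ^~ v)).

Definition smooth_sym2 V (U : set V) (T : V -> V -> V -> R) : Prop :=
  [/\ forall u v, U u -> scalar (T u v),
      forall u v w, U u -> T u v w = T u w v &
      forall v w, smooth U (fun u => T u v w)].

Definition pullback1 V W (F : V -> W) (a : W -> W -> R) : V -> V -> R :=
  fun x v => a (F x) ('d F x v).

Definition pullback2 V W (F : V -> W) (T : W -> W -> W -> R) :
    V -> V -> V -> R :=
  fun x v w => T (F x) ('d F x v) ('d F x w).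

(* [a m U P] is the form a(P) on [U] in R^m, for [P] a plot with domain [U]. *)
Definition form1_family (X : Type) :=
  forall m, set 'rV[R]_m -> ('rV[R]_m -> X) -> 'rV[R]_m -> 'rV[R]_m -> R.

Definition tensor2_family (X : Type) :=
  forall m, set 'rV[R]_m -> ('rV[R]_m -> X) ->
    'rV[R]_m -> 'rV[R]_m -> 'rV[R]_m -> R.

(* In the two definitions below, quantifying over [Q] equal to [P \o F] on [V]
   also makes the value at a plot independent of its values off its domain. *)
Definition is_form1 (X : Type) (D : diffeology R X) (a : form1_family X) :
    Prop :=
  (forall m (U : set 'rV[R]_m) P, plot D U P -> smooth_form1 U (a m U P)) /\
  (forall m n (U : set 'rV[R]_m) (V : set 'rV[R]_n) P Q
      (F : 'rV[R]_n -> 'rV[R]_m),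
    plot D U P -> open V -> smooth V F -> (forall x, V x -> U (F x)) ->
    (forall x, V x -> Q x = P (F x)) ->
    forall x v, V x -> a n V Q x v = pullback1 F (a m U P) x v).

Definition is_sym_tensor2 (X : Type) (D : diffeology R X)
    (t : tensor2_family X) : Prop :=
  (forall m (U : set 'rV[R]_m) P, plot D U P -> smooth_sym2 U (t m U P)) /\
  (forall m n (U : set 'rV[R]_m) (V : set 'rV[R]_n) P Q
      (F : 'rV[R]_n -> 'rV[R]_m),
    plot D U P -> open V -> smooth V F -> (forall x, V x -> U (F x)) ->
    (forall x, V x -> Q x = P (F x)) ->
    forall x v w, V x -> t n V Q x v w = pullback2 F (t m U P) x v w).

(* The vector 1 of R = R^1. *)
Definition one : 'rV[R]_1 := const_mx 1.

(* A path germ at [x] is represented by a plot on an open subset of R^1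
   containing 0, with value [x] at 0. *)
Definition tensor2_positive (X : Type) (D : diffeology R X)
    (g : tensor2_family X) : Prop :=
  forall (x : X) (U : set 'rV[R]_1) (gamma : 'rV[R]_1 -> X),
    plot D U gamma -> U 0 -> gamma 0 = x -> 0 <= g 1%N U gamma 0 one one.

Definition tensor2_definite (X : Type) (D : diffeology R X)
    (g : tensor2_family X) : Prop :=
  forall (x : X) (U : set 'rV[R]_1) (gamma : 'rV[R]_1 -> X),
    plot D U gamma -> U 0 -> gamma 0 = x ->
    (g 1%N U gamma 0 one one = 0 <->
     forall a : form1_family X, is_form1 D a -> a 1%N U gamma 0 one = 0).

Definition riemannian_metric (X : Type) (D : diffeology R X)
    (g : tensor2_family X) : Prop :=
  [/\ is_sym_tensor2 D g, tensor2_positive D g & tensor2_definite D g].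

End Tensors.

Definition half_line (R : realType) := {x : R | 0 <= x}.

Section HalfLine.
Context {R : realType}.

Definition half_line_plot m (U : set 'rV[R]_m) (P : 'rV[R]_m -> half_line R) :
    Prop :=
  open U /\ smooth U (fun u => val (P u) : R).

Lemma half_line_plot_open m (U : set 'rV[R]_m) P :
  half_line_plot U P -> open U.
Proof. by case. Qed.

Lemma half_line_plot_eq_on m (U : set 'rV[R]_m) P Q :
  (forall u, U u -> P u = Q u) -> half_line_plot U P -> half_line_plot U Q.
Proof.
move=> PQ [oU sP]; split=> // k; apply: (Ck_eq_on oU) (sP k) => u /PQ ->.
by [].
Qed.

Lemma half_line_plot_cst m (U : set 'rV[R]_m) x :
  open U -> half_line_plot U (fun=> x).
Proof. by move=> oU; split=> // k; exact: Ck_cst. Qed.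

Lemma half_line_plot_local m (U : set 'rV[R]_m) P : open U ->
  (forall u, U u -> exists2 U', U' u & half_line_plot U' P) ->
  half_line_plot U P.
Proof.
move=> oU H; split=> // k; apply: Ck_local => u /H[U' U'u [_ sP]].
by exists U'; last exact: sP.
Qed.

Lemma half_line_plot_comp m n (U : set 'rV[R]_m) (V : set 'rV[R]_n) P
    (F : 'rV[R]_n -> 'rV[R]_m) :
  half_line_plot U P -> open V -> smooth V F -> (forall v, V v -> U (F v)) ->
  half_line_plot V (P \o F).
Proof.
move=> [oU sP] oV sF FU; split=> // k.
exact: (Ck_comp oV FU (sP k) (sF k)).
Qed.

Definition half_line_diffeology : diffeology R (half_line R) :=
  Diffeology half_line_plot_open half_line_plot_eq_on half_line_plot_cst
    half_line_plot_local half_line_plot_comp.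

(* dx (x) dx / x, meaningful on ]0, +oo[ only. *)
Definition tau_sing : R -> R -> R -> R := fun x v w => v * w / x.

(* g = c tau_sing + tau_reg, where tau_reg is the restriction of [sigma]:
   g(P) is the smooth extension to the whole domain of [P] of
   c dP (x) dP / P + P^*(sigma), which is given by a formula where P > 0 only.
   A symmetric tensor [g] on the half-line is determined by these values:
   [sing_plus_reg_unique].  The extension is required of the sum and not of
   dP (x) dP / P alone, which has none for some plots [P] of dimension at least
   2, such as (s, t) |-> s ^+ 2 + t ^+ 2. *)
Definition is_sing_plus_reg (g : tensor2_family (half_line R)) (c : R)
    (sigma : R -> R -> R -> R) : Prop :=
  forall m (U : set 'rV[R]_m) P, plot half_line_diffeology U P ->
  let p : 'rV[R]_m -> R := fun u => val (P u) in
  forall u v w, U u -> 0 < p u ->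
    g m U P u v w = c * pullback2 p tau_sing u v w + pullback2 p sigma u v w.

Lemma sym_tensor2_near_cst (X : Type) (D : diffeology R X)
    (g : tensor2_family X) m (U A : set 'rV[R]_m) P (y : X) u v w :
  is_sym_tensor2 D g -> plot D U P -> open A -> A `<=` U -> A u ->
  (forall x, A x -> P x = y) -> g m U P u v w = 0.
Proof.
move=> [gs gc] pP oA AU Au Py.
have sid k : Ck k A (id : 'rV[R]_m -> 'rV[R]_m).
  case: k => [|k]; first by move=> x _; exact: cvg_id.
  split=> [x _|a]; first by apply: ex_diff.
  have -> : 'D_a (id : 'rV[R]_m -> 'rV[R]_m) = cst a.
    by apply/funext => x; rewrite derive_id.
  exact: Ck_cst.
have E1 := gc _ _ U A P P id pP oA sid AU (fun _ _ => erefl) u v w Au.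
have did : 'd (id : 'rV[R]_m -> 'rV[R]_m) u = id :> (_ -> _).
  exact: diff_val.
rewrite /pullback2 did in E1.
rewrite -E1.
have p0 := plot_cst D y (@openT 'rV[R]_0).
have sF : smooth A (cst 0 : 'rV[R]_m -> 'rV[R]_0) by move=> k; exact: Ck_cst.
rewrite (gc _ _ setT A _ P (cst 0) p0 oA sF (fun _ _ => I) Py u v w Au).
rewrite /pullback2 diff_cst /=.
have [lin _ _] := gs _ _ _ p0.
have := lin (cst 0 u) 0 I (-1) 0 0.
by rewrite scaler0 addr0 mulN1r addNr.
Qed.

Lemma sing_plus_reg_unique (g g' : tensor2_family (half_line R)) (c : R)
    (sigma : R -> R -> R -> R) :
  is_sym_tensor2 half_line_diffeology g ->
  is_sym_tensor2 half_line_diffeology g' ->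
  is_sing_plus_reg g c sigma -> is_sing_plus_reg g' c sigma ->
  forall m (U : set 'rV[R]_m) P, plot half_line_diffeology U P ->
  forall u v w, U u -> g m U P u v w = g' m U P u v w.
Proof.
move=> tg tg' hg hg' m U P pP u v w Uu.
have oU := plot_open pP.
have [[A [oA Au] AU]|noA] := pselect (exists2 A : set 'rV[R]_m, open A /\ A u &
    forall x, A x -> U x /\ val (P x) = 0 :> R).
  have Pu x : A x -> P x = P u.
    by move=> Ax; apply: val_inj; rewrite (AU x Ax).2 (AU u Au).2.
  have AsU : A `<=` U by move=> z /AU[].
  by rewrite (sym_tensor2_near_cst _ _ tg pP oA AsU Au Pu)
             (sym_tensor2_near_cst _ _ tg' pP oA AsU Au Pu).
have [_ _ sg] := tg.1 _ _ _ pP; have [_ _ sg'] := tg'.1 _ _ _ pP.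
have cg := sg v w 0%N u Uu; have cg' := sg' v w 0%N u Uu.
set d := fun x => g m U P x v w - g' m U P x v w.
have cd : {for u, continuous d} by exact: (continuousB cg cg').
apply/eqP; rewrite -subr_eq0; apply/negP => /negP dn0.
have nd : \forall x \near u, d x != 0.
  apply: (cd (fun y : R => y != 0)).
  exact: open_nbhs_nbhs (conj (@open_neq R 0) dn0).
have := open_nbhs_nbhs (conj oU Uu) => nU.
have [A [oA Au] sA] : exists2 A, open_nbhs u A &
    A `<=` [set x | d x != 0] `&` U.
  by have := @filterI _ _ (nbhs_filter u) _ _ nd nU; rewrite nbhsE.
apply: noA; exists A => // x Ax; have [dx Ux] := sA x Ax; split=> //.
have := valP (P x); rewrite le_eqVlt => /orP[/eqP <- //|Px].
have : d x != 0 := dx.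
by rewrite /d (hg _ _ _ pP) // (hg' _ _ _ pP) // subrr eqxx.
Qed.

End HalfLine.

(* Main.v *)
(** The function [t |-> t^2] is a plot of the half-line invariant under
    [t |-> - t], so every 1-form on the half-line, pulled back by it, is odd and
    vanishes at [0]; definiteness then forces [g(t^2)_0(1,1) = 0].  On the other
    hand [g(t^2)_t(1,1) = c (2t)^2 / t^2 + (2t)^2 sigma(t^2)(1,1)] for [t <> 0],
    which tends to [4c] at [0]. *)
From HB Require Import structures.
Require Import Defs.
From mathcomp Require Import all_boot all_order all_algebra.
From mathcomp Require Import all_classical all_reals all_analysis.
From mathcomp Require Import ring.
Import Order.TTheory GRing.Theory Num.Theory numFieldNormedType.Exports.

Local Open Scope ring_scope.
Local Open Scope classical_set_scope.

Lemma smooth_id (R : realType) (V : normedModType R) (U : set V) :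
  smooth U (id : V -> V).
Proof.
(* No induction on the order: each directional derivative is constant, hence of class C^k for all
   k. *)
case=> [|k]; first by move=> x _; exact: cvg_id.
split=> [x _|v]; first exact: ex_diff.
have -> : 'D_v (id : V -> V) = cst v by apply/funext => x; rewrite derive_id.
exact: Ck_cst.
Qed.

Lemma smooth_opp (R : realType) (V : normedModType R) (U : set V) :
  smooth U (-%R : V -> V).
Proof.
case=> [|k]; first by move=> x _; exact: opp_continuous.
split=> [x _|v]; first exact: ex_diff.
have -> : 'D_v (-%R : V -> V) = cst (- v).
  apply/funext => x.
  by rewrite -[-%R]/(- (id : V -> V)) deriveN ?derive_id //; exact: derivable_id.
exact: Ck_cst.
Qed.

Section SquarePlot.
Context {R : realType}.

Local Notation vec1 := (@Defs.one R).

Definition square_plot (u : 'rV[R]_1) : half_line R :=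
  exist _ (u ord0 ord0 ^+ 2) (sqr_ge0 (u ord0 ord0)).

Lemma plot_square_plot : plot (half_line_diffeology (R := R)) setT square_plot.
Proof.
split; first exact: openT.
have sc k : Ck k setT (fun u : 'rV[R]_1 => u ord0 ord0).
  exact: (Ck_coord ord0 openT (smooth_id _ _ _ k)).
by move=> k; exact: (Ck_mul openT (sc k) (sc k)).
Qed.

Lemma diff_square_plot (u v : 'rV[R]_1) :
  'd (fun u => val (square_plot u) : R) u v
  = 2 * u ord0 ord0 * v ord0 ord0.
Proof.
have dc : differentiable (fun u : 'rV[R]_1 => u ord0 ord0 : R) u.
  exact: differentiable_coord.
have lc : linear (fun u : 'rV[R]_1 => u ord0 ord0 : R).
  by move=> a x y; rewrite !mxE.
(* Bundled as a continuous linear map, the coordinate is its own differential; the product rule then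
   handles the square. *)
pose cl := GRing.isLinear.Build _ _ _ _ _ lc.
pose C : {linear 'rV[R]_1 -> R} := HB.pack (fun u : 'rV[R]_1 => u ord0 ord0) cl.
have dC : 'd (fun u : 'rV[R]_1 => u ord0 ord0 : R) u = C :> (_ -> _).
  by apply: (diff_lin (f := C)); exact: coord_continuous.
rewrite -[X in 'd X u](_ : (fun u : 'rV[R]_1 => u ord0 ord0 : R)
  * (fun u => u ord0 ord0) = _) //.
rewrite diffM // dC.
rewrite -[LHS]/(u ord0 ord0 * v ord0 ord0 + u ord0 ord0 * v ord0 ord0).
by ring.
Qed.

Lemma form1_square_plot_eq0 (a : form1_family (half_line R)) :
  is_form1 half_line_diffeology a -> a 1%N setT square_plot 0 vec1 = 0.
Proof.
move=> [a_form a_comp].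
have even_sq (x : 'rV[R]_1) : setT x -> square_plot x = square_plot (- x).
  by move=> _; apply: val_inj; rewrite /= mxE sqrrN.
(* Naturality under [-%R], which fixes 0, equates the values of the form at 0 on [vec1] and on
   [- vec1]; linearity makes them opposite, so twice the value is 0. *)
have := a_comp 1%N 1%N setT setT _ _ _ plot_square_plot openT
  (smooth_opp _ _ _) (fun _ _ => I) even_sq 0 vec1 I.
rewrite /pullback1 oppr0.
have -> : 'd (-%R : 'rV[R]_1 -> 'rV[R]_1) 0 vec1 = - vec1.
  by rewrite diff_lin //; exact: opp_continuous.
have [lin _] := a_form _ _ _ plot_square_plot.
have lin0 := lin 0 I.
have -> : a 1%N setT square_plot 0 (- vec1) = - a 1%N setT square_plot 0 vec1.
  have a0 : a 1%N setT square_plot 0 0 = 0.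
    by have := lin0 (-1) 0 0; rewrite scaler0 addr0 mulN1r addNr.
  by have := lin0 (-1) vec1 0; rewrite scaleN1r addr0 a0 addr0 mulN1r.
by move/eqP; rewrite -addr_eq0 -mulr2n mulrn_eq0 /= => /eqP.
Qed.

(** The formula for [g] says nothing at 0, where the plot vanishes; the value there is recovered by
    continuity from $t \neq 0$. *)
Lemma sing_plus_reg_square_plot (g : tensor2_family (half_line R)) (c : R)
    (sigma : R -> R -> R -> R) :
  smooth_sym2 setT sigma -> is_sing_plus_reg g c sigma ->
  is_sym_tensor2 half_line_diffeology g ->
  g 1%N setT square_plot 0 vec1 vec1 = 4 * c.
Proof.
move=> [sigma_lin sigma_sym sigma_smooth] gcs [g_smooth _].
have [_ _ gsq] := g_smooth _ _ _ plot_square_plot.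
(* Linearity is given in the last slot only; symmetry carries it to the other one. *)
have sigma_diag x a : sigma x a a = a ^+ 2 * sigma x 1 1.
  have hom y b : sigma x y b = b * sigma x y 1.
    have s0 : sigma x y 0 = 0.
      by have := sigma_lin x y I (-1) 0 0; rewrite scaler0 addr0 mulN1r addNr.
    have := sigma_lin x y I b 1 0.
    by rewrite addr0 s0 addr0 /GRing.scale /= mulr1.
  by rewrite hom sigma_sym // hom mulrA expr2.
(* Removing the regular part $(2t)^2\sigma(t^2)(1,1)$ leaves $c(2t)^2/t^2 = 4c$ for $t \neq 0$; at
   $t = 0$ the removed term is 0. *)
pose h (t : R) := g 1%N setT square_plot (t *: vec1) vec1 vec1
                  - 4 * (t ^+ 2 * sigma (t ^+ 2) 1 1).
have h_eq t : t != 0 -> h t = 4 * c.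
  move=> t0; have t2 : 0 < t ^+ 2 by rewrite exprn_even_gt0.
  have E : (t *: vec1) ord0 ord0 = t :> R by rewrite !mxE mulr1.
  rewrite /h (gcs _ _ _ plot_square_plot) //=; last by rewrite E.
  rewrite /pullback2 /tau_sing !diff_square_plot /= E [vec1 _ _]mxE mulr1.
  by rewrite sigma_diag; field.
have sq_cont : {for 0, continuous (fun t : R => t ^+ 2)}.
  exact: exprn_continuous.
have h_cont : {for 0, continuous h}.
  apply: continuousB.
    apply: (@continuous_comp _ _ _ (fun t : R => t *: vec1)
      (fun u => g 1%N setT square_plot u vec1 vec1)).
      exact: scalel_continuous.
    exact: (gsq vec1 vec1 0%N).
  apply: continuousM; first exact: cst_continuous.
  apply: continuousM; first exact: sq_cont.
  apply: (@continuous_comp _ _ _ (fun t : R => t ^+ 2) (fun x => sigma x 1 1)).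
    exact: sq_cont.
  exact: (sigma_smooth 1 1 0%N).
have h0 : h 0 = g 1%N setT square_plot 0 vec1 vec1.
  by rewrite /h scale0r expr0n /= mul0r mulr0 subr0.
rewrite -h0.
(* Along the punctured neighbourhoods of 0, [h] tends to [h 0] by continuity and to [4 * c] since it
   is constant there. *)
have lim0 : h x @[x --> 0^'] --> h 0.
  exact: (cvg_trans (cvg_app h (@nbhs_dnbhs _ _)) h_cont).
have lim4c : h x @[x --> 0^'] --> 4 * c.
  by apply: cvg_near_cst; apply: filterS (nbhs_dnbhs_neq (0 : R)) => t /h_eq.
exact: (cvg_unique (@norm_hausdorff _ R) lim0 lim4c).
Qed.

End SquarePlot.

Theorem proposition3p2 (R : realType) (g : @tensor2_family R (half_line R))
    (c : R) (sigma : R -> R -> R -> R) :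
  smooth_sym2 setT sigma ->
  is_sing_plus_reg g c sigma ->
  riemannian_metric (@half_line_diffeology R) g ->
  c = 0.
Proof.
move=> sigma_sm gcs [g_sym _ g_def].
have /eqP : g 1%N setT square_plot 0 Defs.one Defs.one = 0.
  (* Definiteness is used from right to left, at the endpoint [square_plot 0]: all 1-forms vanish on
     the path, hence so does [g]. *)
  apply/(g_def _ _ _ plot_square_plot I erefl) => a.
  exact: form1_square_plot_eq0.
rewrite (sing_plus_reg_square_plot _ _ _ sigma_sm gcs g_sym).
by rewrite mulf_eq0 pnatr_eq0 /= => /eqP.
Qed.
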